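(* Let $G$ and $H$ be primitive strongly regular graphs with the same adjacency cosine $\alpha$, and with non-adjacency cosines $\beta$ and $\beta'$ respectively. Suppose $\varphi$ is a homomorphism from $G$ to $H$. Then: (1) if $\beta>\beta'$, then $\varphi$ is a coloring; (2) if $\beta=\beta'$, then $\varphi$ is either a coloring or an isomorphism from $G$ to an induced subgraph of $H$ (i.e. $\varphi$ is injective and $u\sim v \iff \varphi(u)\sim\varphi(v)$).
   Context: A graph is strongly regular with parameters $(n,k,\lambda,\mu)$ if it has $n$ vertices, is $k$-regular, every pair of adjacent vertices has $\lambda$ common neighbors and every pair of distinct non-adjacent vertices has $\mu$ common neighbors. It is primitive if neither it nor its complement is disconnected. For a primitive strongly regular graph with parameters $(n,k,\lambda,\mu)$ and least adjacency eigenvalue $\tau$, its adjacency cosine is $\tau/k$ and its non-adjacency cosine is $(-\tau-1)/(n-k-1)$. A homomorphism from $G$ to $H$ is a map $\varphi:V(G)\to V(H)$ with $\varphi(u)\sim\varphi(v)$ whenever $u\sim v$. A homomorphism is a coloring if its image $\{\varphi(u):u\in V(G)\}$ induces a clique (complete subgraph) of $H$. *)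

(* Defs.v *)
From HB Require Import structures.
From mathcomp Require Import all_boot all_order all_algebra.
From mathcomp Require Import reals.

Set Implicit Arguments.
Unset Strict Implicit.
Unset Printing Implicit Defensive.

Import Order.TTheory GRing.Theory Num.Theory.
Local Open Scope ring_scope.

Record graph := Graph {
  vertex :> finType;
  adj : rel vertex;
  adj_sym : symmetric adj;
  adj_irrefl : irreflexive adj }.

Arguments adj {g} _ _.

Definition compl_adj (G : graph) : rel G :=
  fun x y => (x != y) && ~~ adj x y.

Lemma compl_adj_sym (G : graph) : symmetric (@compl_adj G).
Proof. by move=> x y; rewrite /compl_adj eq_sym adj_sym. Qed.

Lemma compl_adj_irrefl (G : graph) : irreflexive (@compl_adj G).
Proof. by move=> x; rewrite /compl_adj eqxx. Qed.

Definition compl (G : graph) : graph :=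
  Graph (@compl_adj_sym G) (@compl_adj_irrefl G).

Definition neighbors (G : graph) (x : G) : {set G} := [set y | adj x y].

Record strongly_regular (G : graph) (n k lambda mu : nat) : Prop := {
  srg_order : #|G| = n;
  srg_regular : forall x : G, #|neighbors x| = k;
  srg_adj : forall x y : G, adj x y ->
    #|neighbors x :&: neighbors y| = lambda;
  srg_nonadj : forall x y : G, x != y -> ~~ adj x y ->
    #|neighbors x :&: neighbors y| = mu }.

Definition connected (G : graph) : Prop :=
  forall x y : G, connect (@adj G) x y.

Definition primitive (G : graph) : Prop :=
  connected G /\ connected (compl G).

Definition adjacency_matrix (R : realType) (G : graph) : 'M[R]_#|G| :=
  \matrix_(i, j) (adj (enum_val i) (enum_val j))%:R.

Definition least_eigenvalue (R : realType) (G : graph) (tau : R) : Prop :=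
  eigenvalue (adjacency_matrix R G) tau /\
  forall a : R, eigenvalue (adjacency_matrix R G) a -> tau <= a.

Definition adjacency_cosine (R : realType) (k : nat) (tau : R) : R :=
  tau / k%:R.

(* The denominator is subtracted in R, so it is not truncated. *)
Definition nonadjacency_cosine (R : realType) (n k : nat) (tau : R) : R :=
  (- tau - 1) / (n%:R - k%:R - 1).

Definition homomorphism (G H : graph) (phi : G -> H) : Prop :=
  forall u v : G, adj u v -> adj (phi u) (phi v).

Definition clique (G : graph) (S : {set G}) : Prop :=
  {in S &, forall x y : G, x != y -> adj x y}.

Definition coloring (G H : graph) (phi : G -> H) : Prop :=
  homomorphism phi /\ clique [set phi u | u : G].

Definition induced_embedding (G H : graph) (phi : G -> H) : Prop :=
  injective phi /\ forall u v : G, adj u v <-> adj (phi u) (phi v).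

(* Main.v *)
Require Import Defs.
From HB Require Import structures.
From mathcomp Require Import all_boot all_order all_algebra.
From mathcomp Require Import reals ring lra.

(* The matrix M_H = I + alpha A + beta' (J - I - A) of H is, up to a positive
   factor, the projection onto the least eigenspace, hence a Gram matrix; so is
   its pullback M along phi. Since M has diagonal 1 and value alpha on edges of
   G, the inner product of M with A_G - tau is n k alpha - n tau = 0, and as both
   are positive semidefinite, A_G M = tau M. Let u, v be such that phi u, phi v
   are distinct and nonadjacent, so that M u v = beta'. Comparing this equation
   at (u, v) with the one satisfied by M_G, the entries M w v - beta, for w
   adjacent to u but not to v, sum to tau (beta' - beta). None of these entries
   is 1, as phi w = phi v would make phi u and phi v adjacent; hence they are
   alpha or beta', and if beta' <= beta this forces beta' = beta and all of them
   to be beta'. So the pair (w, v) is again separated by phi, and connectedness of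
   the non-neighbors of v and of the complement of G shows that phi separates
   all nonadjacent pairs as soon as it separates one. *)

Set Implicit Arguments.
Unset Strict Implicit.
Unset Printing Implicit Defensive.

Import Order.TTheory GRing.Theory Num.Theory.
Local Open Scope ring_scope.

(** * Propagation along paths and the degenerate graphs *)

Lemma connect_invariant (T : finType) (e : rel T) (P : T -> Prop) (x y : T) :
  (forall u v, P u -> e u v -> P v) -> P x -> connect e x y -> P y.
Proof.
move=> Pe Px /connectP[p + ->].
by elim: p x Px => //= z p IH x Px /andP[xz]; apply: IH; apply: Pe xz.
Qed.

Lemma card_gt1_neq (T : finType) (x : T) : (1 < #|T|)%N -> exists y, y != x.
Proof.
move=> T1; have : (0 < #|[set~ x]|)%N by rewrite cardsC1 -subn1 subn_gt0.
by move=> /card_gt0P[y]; rewrite !inE; exists y.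
Qed.

(** Graphs with at most one vertex satisfy [primitive]; disposing of them here lets the rest assume
    two vertices. *)
Lemma coloring_subsingleton (G H : graph) (phi : G -> H) :
  homomorphism phi -> (#|G| <= 1)%N \/ (#|H| <= 1)%N -> coloring phi.
Proof.
move=> hom small; split=> // _ _ /imsetP[u _ ->] /imsetP[v _ ->].
case: small => /card_le1_eqP eq_all.
  by rewrite (eq_all u v) // eqxx.
by rewrite (eq_all (phi u) (phi v)) // eqxx.
Qed.

(** * Parameter inequalities forced by primitivity *)

Section StronglyRegularGraph.

Variables (G : graph) (n k l m : nat).
Hypothesis srgG : strongly_regular G n k l m.
Hypothesis primG : primitive G.
Hypothesis G_gt1 : (1 < #|G|)%N.

Let vertex_exists : exists x : G, true.
Proof. by have /card_gt0P[x] := ltnW G_gt1; exists x. Qed.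

Lemma srg_neighbor_exists (x : G) : exists y, adj x y.
Proof.
have [z z_neq] := card_gt1_neq x G_gt1.
case: (pickP (adj x)) => [y xy|no]; first by exists y.
case/negP: z_neq; apply/eqP.
apply: (connect_invariant (P := fun w => w = x)) (primG.1 x z) => //.
by move=> u v ->; rewrite no.
Qed.

Lemma srg_nonneighbor_exists (x : G) : exists2 y, y != x & ~~ adj x y.
Proof.
have [z z_neq] := card_gt1_neq x G_gt1.
case: (pickP (compl_adj x)) => [y /andP[xy nxy]|no].
  by exists y; rewrite // eq_sym.
case/negP: z_neq; apply/eqP.
apply: (connect_invariant (P := fun w => w = x)) (primG.2 x z) => //.
by move=> u v ->; rewrite /= no.
Qed.

Lemma srg_degree_gt0 : (0 < k)%N.
Proof.
have [x _] := vertex_exists; have [y xy] := srg_neighbor_exists x.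
by rewrite -(srg_regular srgG x); apply/card_gt0P; exists y; rewrite inE.
Qed.

Lemma srg_degree_lt : (k.+1 < n)%N.
Proof.
have [x _] := vertex_exists; have [y yx nxy] := srg_nonneighbor_exists x.
rewrite -(srg_order srgG) -(srg_regular srgG x).
have xN : x \notin neighbors x by rewrite inE adj_irrefl.
have -> : #|neighbors x|.+1 = #|x |: neighbors x| by rewrite cardsU1 xN.
have yN : y \notin x |: neighbors x by rewrite !inE negb_or yx.
have : (#|y |: (x |: neighbors x)| <= #|G|)%N by apply: max_card.
by rewrite cardsU1 yN.
Qed.

(* If m = 0, adjacency-or-equality is transitive, so connectedness of G would
   make it complete. *)
Lemma srg_mu_gt0 : (0 < m)%N.
Proof.
rewrite lt0n; apply/eqP => m0.
have [x _] := vertex_exists; have [y yx nxy] := srg_nonneighbor_exists x.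
suff: (y == x) || adj x y by rewrite (negPf yx) (negPf nxy).
apply: (connect_invariant (P := fun w => (w == x) || adj x w)) (primG.1 x y).
  move=> u v /orP[/eqP->->|xu uv]; first by rewrite orbT.
  rewrite eq_sym; have [//|xv /=] := eqVneq x v.
  apply/negPn/negP => nxv; have := srg_nonadj srgG xv nxv.
  rewrite m0 => /eqP; rewrite cards_eq0 => /eqP/setP/(_ u).
  by rewrite !inE xu adj_sym uv.
by rewrite eqxx.
Qed.

(* If m = k, distinct nonadjacent vertices have the same neighbors, so
   connectedness of the complement would leave G without edges. *)
Lemma srg_mu_lt : (m < k)%N.
Proof.
have sub (x y : G) : x != y -> ~~ adj x y -> (k <= m)%N ->
    forall w, adj x w -> adj y w.
  move=> xy nxy km w xw.
  have : neighbors x :&: neighbors y == neighbors x.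
    rewrite eqEcard subsetIl (srg_nonadj srgG xy nxy).
    by rewrite (srg_regular srgG).
  by move/eqP/setP/(_ w); rewrite !inE xw.
rewrite ltnNge; apply/negP => km.
have [x _] := vertex_exists; have [y xy] := srg_neighbor_exists x.
suff: adj y y by rewrite adj_irrefl.
apply: (connect_invariant (P := fun w => adj w y)) (primG.2 x y) => // u v uy.
by case/andP=> uv nuv; apply: sub uy.
Qed.

Lemma srg_lambda_lt : (l.+1 < k)%N.
Proof.
(* Some path x, u, y has x, y distinct and nonadjacent, because m > 0; then y is
   a neighbor of u that is neither x nor a neighbor of x. *)
have [x _] := vertex_exists; have [y yx nxy] := srg_nonneighbor_exists x.
have xy : x != y by rewrite eq_sym.
have : (0 < #|neighbors x :&: neighbors y|)%N.
  by rewrite (srg_nonadj srgG xy nxy) srg_mu_gt0.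
case/card_gt0P=> u; rewrite !inE => /andP[xu yu].
have ux : adj u x by rewrite adj_sym.
rewrite -(srg_regular srgG u) -(srg_adj srgG ux).
set S := _ :&: _.
have xS : x \notin S by rewrite !inE adj_irrefl andbF.
have yS : y \notin x |: S by rewrite !inE negb_or yx (negPf nxy) andbF.
have : (#|y |: (x |: S)| <= #|neighbors u|)%N.
  apply: subset_leq_card; apply/subsetP => w.
  rewrite !inE => /or3P[/eqP->|/eqP->|/andP[]//]; first by rewrite adj_sym.
  exact: ux.
by rewrite cardsU1 yS cardsU1 xS.
Qed.


(** * The algebra spanned by I, A and J *)

Variable R : realType.
Implicit Types (f : G -> R) (p q r s t : R).

Local Notation A x y := ((adj x y)%:R : R).

Lemma sum_delta f (x : G) : \sum_y (x == y)%:R * f y = f x.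
Proof.
rewrite (bigD1 x) //= eqxx mul1r big1 ?addr0 // => y yx.
by rewrite eq_sym (negPf yx) mul0r.
Qed.

Lemma sum_adj (x : G) : \sum_y A x y = k%:R.
Proof.
rewrite -(srg_regular srgG x) -sum1_card natr_sum [RHS]big_mkcond.
by apply: eq_bigr => y _; rewrite inE; case: (adj x y).
Qed.

Lemma sum_adj_adj (x y : G) : \sum_w A x w * A w y =
  k%:R * (x == y)%:R + l%:R * A x y + m%:R * (1 - (x == y)%:R - A x y).
Proof.
have -> : \sum_w A x w * A w y = #|neighbors x :&: neighbors y|%:R.
  rewrite -sum1_card natr_sum [RHS]big_mkcond; apply: eq_bigr => w _.
  by rewrite !inE (adj_sym y) -natrM mulnb; case: (_ && _).
have [<-|xy] := eqVneq x y.
  by rewrite setIid (srg_regular srgG) adj_irrefl ?eqxx /= mulr1n mulr0n; ring.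
have [xy_adj|nxy] := boolP (adj x y).
  by rewrite (srg_adj srgG) //= mulr1n mulr0n; ring.
by rewrite (srg_nonadj srgG) //= mulr0n; ring.
Qed.

(** Sum row [x] of the identity for A^2: the walks of length two from [x] number k^2. *)
Lemma srg_count : k%:R * (k%:R - l%:R - 1) = (n%:R - k%:R - 1) * m%:R :> R.
Proof.
have [x _] := vertex_exists.
have : \sum_y \sum_w A x w * A w y = k%:R * k%:R.
  rewrite exchange_big /=; under eq_bigr do rewrite -mulr_sumr sum_adj.
  by rewrite -mulr_suml sum_adj.
have dlt : \sum_y (x == y)%:R = 1 :> R.
  by rewrite -[RHS](sum_delta (fun=> 1) x); apply: eq_bigr => y _; rewrite mulr1.
under eq_bigr do rewrite sum_adj_adj.
rewrite !big_split /= -!mulr_sumr !big_split /= !sumrN dlt sum_adj sumr_const.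
rewrite (srg_order srgG) => e; nra.
Qed.

Definition scheme_mx p q r (x y : G) : R := p * (x == y)%:R + q * A x y + r.

Lemma scheme_mxC p q r (x y : G) : scheme_mx p q r x y = scheme_mx p q r y x.
Proof. by rewrite /scheme_mx eq_sym adj_sym. Qed.

Lemma sum_scheme_mx p q r f (x : G) : \sum_y scheme_mx p q r x y * f y =
  p * f x + q * (\sum_y A x y * f y) + r * \sum_y f y.
Proof.
rewrite /scheme_mx; under eq_bigr do rewrite !mulrDl -!mulrA.
by rewrite !big_split /= -!mulr_sumr sum_delta.
Qed.

(** Expand (pI + qA + rJ)^2 with A^2 = (k-m)I + (l-m)A + mJ, AJ = JA = kJ and J^2 = nJ. *)
Lemma scheme_mx_sqr p q r (x y : G) :
  \sum_w scheme_mx p q r x w * scheme_mx p q r w y =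
  scheme_mx (p ^+ 2 + q ^+ 2 * (k%:R - m%:R))
    (2 * p * q + q ^+ 2 * (l%:R - m%:R))
    (q ^+ 2 * m%:R + 2 * r * (p + q * k%:R) + r ^+ 2 * n%:R) x y.
Proof.
rewrite sum_scheme_mx.
have -> : \sum_w A x w * scheme_mx p q r w y =
    p * A x y + q * (\sum_w A x w * A w y) + r * k%:R.
  rewrite /scheme_mx.
  under eq_bigr do rewrite !mulrDr (mulrC (A x _) r) -!(mulrCA _ (A x _)).
  rewrite !big_split /= -!mulr_sumr sum_adj.
  congr (_ * _ + _ + _).
  rewrite -(sum_delta (fun v => A x v) y); apply: eq_bigr => w _.
  by rewrite mulrC eq_sym.
have -> : \sum_w scheme_mx p q r w y = p + q * k%:R + r * n%:R.
  under eq_bigr do rewrite scheme_mxC -[scheme_mx _ _ _ _ _]mulr1.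
  rewrite sum_scheme_mx; under eq_bigr do rewrite mulr1.
  by rewrite sum_adj mulr1 sumr_const (srg_order srgG).
rewrite sum_adj_adj /scheme_mx; ring.
Qed.

(** * Eigenvalues of A and positivity of A - tau *)

Lemma eigenvalue_adjP (a : R) : eigenvalue (adjacency_matrix R G) a <->
  exists f, (forall x, \sum_y A x y * f y = a * f x) /\ exists x, f x != 0.
Proof.
split=> [/eigenvalueP[v va v0]|[f [fa [x0 fx0]]]].
  exists (fun x => v 0 (enum_rank x)); split.
    move=> x; have := congr1 (fun w : 'rV__ => w 0 (enum_rank x)) va.
    rewrite !mxE => <-; rewrite (reindex (fun i : 'I_#|G| => enum_val i)) /=; last first.
      by apply: onW_bij; apply: enum_val_bij.
    apply: eq_bigr => i _.
    by rewrite mxE enum_rankK enum_valK adj_sym mulrC.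
  have [i vi] : exists i, v 0 i != 0.
    apply/existsP; apply: contraNT v0 => /existsPn v0.
    by apply/eqP/rowP => i; rewrite mxE; apply/eqP/negPn.
  by exists (enum_val i); rewrite enum_valK.
apply/eigenvalueP; exists (\row_i f (enum_val i)).
  apply/rowP => i; rewrite !mxE -fa [RHS](reindex (fun i : 'I_#|G| => enum_val i)) /=; last first.
    by apply: onW_bij; apply: enum_val_bij.
  by apply: eq_bigr => j _; rewrite !mxE adj_sym mulrC.
apply: contra_neq fx0 => /rowP/(_ (enum_rank x0)).
by rewrite !mxE enum_rankK.
Qed.

(* The columns of A - s are t-eigenvectors up to a multiple of the constant
   vector, which cancels in the difference of two columns. *)
Lemma srg_root_eigenvalue s t :
  s + t = l%:R - m%:R -> s * t = m%:R - k%:R -> 0 < s ->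
  eigenvalue (adjacency_matrix R G) t.
Proof.
move=> st1 st2 s_gt0; apply/eigenvalue_adjP.
have [x _] := vertex_exists; have [y xy] := card_gt1_neq x G_gt1.
exists (fun w => A w x - A w y - s * (w == x)%:R + s * (w == y)%:R).
split; last first.
  exists x; rewrite adj_irrefl eqxx [x == y]eq_sym (negPf xy) /= mulr1n mulr0n.
  by have : 0 <= A x y by []; move=> ?; apply: ltr0_neq0; lra.
move=> w; under eq_bigr do rewrite mulrDr !mulrBr.
rewrite !(big_split, sumrN) /= !sum_adj_adj.
have dl (z : G) : \sum_v A w v * (s * (v == z)%:R) = s * A w z.
  rewrite -(sum_delta (fun v => A w v) z) mulr_sumr; apply: eq_bigr => v _.
  by rewrite eq_sym; ring.
rewrite !dl.
have -> : m%:R = s * t + k%:R :> R by lra.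
have -> : l%:R = s + t + s * t + k%:R :> R by lra.
ring.
Qed.

(** [theta] is the other root of x^2 = (l-m)x + (k-m). That [tau] is a root follows by applying A^2
    to an eigenvector, which has zero sum because [tau] is negative and so differs from k. *)
Lemma least_eigenvalue_root (tau : R) : least_eigenvalue G tau ->
  exists theta : R, [/\ tau + theta = l%:R - m%:R,
    tau * theta = m%:R - k%:R, 0 < theta, tau < -1 &
    n%:R * m%:R = (k%:R - tau) * (k%:R - theta)].
Proof.
move=> [tau_eig tau_min].
have mk : m%:R < k%:R :> R by rewrite ltr_nat srg_mu_lt.
have lk : l%:R + 1 < k%:R :> R by rewrite natr1 ltr_nat srg_lambda_lt.
pose b : R := l%:R - m%:R; pose D := b ^+ 2 + 4 * (k%:R - m%:R).
have D_ge0 : 0 <= D by rewrite /D; have := sqr_ge0 b; lra.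
have D2 := sqr_sqrtr D_ge0; have sD := sqrtr_ge0 D.
set d := Num.sqrt D in D2 sD.
(* As m < k, the roots (b - d)/2 and (b + d)/2 have opposite signs; the negative one is an
   eigenvalue, hence bounds [tau]. *)
have bd : `|b| < d.
  rewrite -(@ltr_pXn2r _ 2) ?nnegrE // real_normK ?num_real // D2 /D; lra.
have [bd1 bd2] : - d < b /\ b < d by apply/andP; rewrite -ltr_norml.
have tau_lt0 : tau < 0.
  apply: (@le_lt_trans _ _ ((b - d) / 2)); last by lra.
  apply: tau_min; apply: (@srg_root_eigenvalue ((b + d) / 2)).
  - by rewrite -/b; field.
  - have -> : (b + d) / 2 * ((b - d) / 2) = (b ^+ 2 - d ^+ 2) / 4 by field.
    by rewrite D2 /D; field.
  - lra.
have [f [f_eig [x fx]]] := (eigenvalue_adjP tau).1 tau_eig.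
have k0 : 0 <= k%:R :> R by [].
have f_sum : \sum_y f y = 0.
  have : \sum_x \sum_y A x y * f y = k%:R * \sum_y f y.
    rewrite exchange_big /= mulr_sumr; apply: eq_bigr => y _.
    rewrite -mulr_suml -(sum_adj y); congr (_ * _).
    by apply: eq_bigr => z _; rewrite adj_sym.
  under eq_bigr do rewrite f_eig; rewrite -mulr_sumr => /eqP.
  rewrite -subr_eq0 -mulrBl mulf_eq0 => /orP[|/eqP//].
  by move=> /eqP ?; lra.
have quad : tau ^+ 2 = (l%:R - m%:R) * tau + (k%:R - m%:R).
  have : \sum_w A x w * (\sum_y A w y * f y) = tau ^+ 2 * f x.
    under eq_bigr do rewrite f_eig mulrCA; rewrite -mulr_sumr f_eig; ring.
  have -> : \sum_w A x w * (\sum_y A w y * f y) =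
      \sum_y (\sum_w A x w * A w y) * f y.
    under eq_bigr do rewrite mulr_sumr; rewrite exchange_big /=.
    apply: eq_bigr => y _; rewrite mulr_suml.
    by apply: eq_bigr => w _; rewrite mulrA.
  have -> : \sum_y (\sum_w A x w * A w y) * f y =
      \sum_y scheme_mx (k%:R - m%:R) (l%:R - m%:R) m%:R x y * f y.
    apply: eq_bigr => y _; rewrite sum_adj_adj /scheme_mx; ring.
  rewrite sum_scheme_mx f_eig f_sum => e.
  by apply: (mulIf fx); rewrite -e; ring.
exists (l%:R - m%:R - tau).
have prod : tau * (l%:R - m%:R - tau) = m%:R - k%:R by nra.
have theta_gt0 : 0 < l%:R - m%:R - tau by nra.
split=> //; first by ring.
  (* (-1 - tau) (-1 - theta) = 1 + l - k < 0 *)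
  nra.
(* By Vieta the right side is k(k-l-1) + (k+1)m. *)
have := srg_count; nra.
Qed.

(** [E] kills the constants and the s-eigenspace and acts as t - s on the t-eigenspace. It is
    applied with both orders of [tau] and [theta]. *)
Lemma srg_idempotent s t : s + t = l%:R - m%:R -> s * t = m%:R - k%:R ->
  n%:R * m%:R = (k%:R - s) * (k%:R - t) ->
  let E := scheme_mx (- s) 1 (- ((k%:R - s) / n%:R)) in
  forall x y, \sum_w E x w * E w y = (t - s) * E x y.
Proof.
move=> st1 st2 nm E x y; rewrite /E scheme_mx_sqr /scheme_mx.
have n0 : n%:R != 0 :> R.
  by rewrite pnatr_eq0 -(srg_order srgG) -lt0n ltnW.
have mE : m%:R = (k%:R - s) * (k%:R - t) / n%:R :> R by rewrite -nm; field.
have -> : l%:R - m%:R = s + t by lra.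
have -> : k%:R - m%:R = - (s * t) by lra.
by rewrite mE; field.
Qed.

(* With c = (k - tau) / n, E = A - tau - c J satisfies E^2 = (theta - tau) E,
   so A - tau is positive semidefinite without appeal to the spectral
   theorem. *)
Lemma least_eigenvalue_form (tau : R) (z : G -> R) : least_eigenvalue G tau ->
  0 <= \sum_x z x * (\sum_y A x y * z y - tau * z x) /\
  (\sum_x z x * (\sum_y A x y * z y - tau * z x) = 0 ->
   forall x, \sum_y A x y * z y = tau * z x).
Proof.
move=> /least_eigenvalue_root[theta [st1 st2 th_gt0 tau_lt nm]].
have n_gt0 : 0 < n%:R :> R by rewrite ltr0n -(srg_order srgG) ltnW.
pose c := (k%:R - tau) / n%:R.
have c_gt0 : 0 < c.
  by rewrite divr_gt0 //; have : 0 <= k%:R :> R by []; lra.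
have d_gt0 : 0 < theta - tau by lra.
pose E := scheme_mx (- tau) 1 (- c).
have EC x y : E x y = E y x by apply: scheme_mxC.
pose Ez x := \sum_y E x y * z y.
have EzE x : Ez x = \sum_y A x y * z y - tau * z x - c * \sum_y z y.
  by rewrite /Ez sum_scheme_mx !mulNr mul1r [- _ + _]addrC.
have Ez2 : \sum_x Ez x ^+ 2 = (theta - tau) * \sum_x z x * Ez x.
  have -> : \sum_x Ez x ^+ 2 = \sum_x \sum_y \sum_w z y * z w * (E y x * E x w).
    apply: eq_bigr => x _; rewrite expr2 {1}/Ez mulr_suml.
    apply: eq_bigr => y _; rewrite mulr_sumr.
    by apply: eq_bigr => w _; rewrite (EC x y); ring.
  rewrite exchange_big mulr_sumr; apply: eq_bigr => y _.
  rewrite exchange_big mulrA mulr_sumr; apply: eq_bigr => w _ /=.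
  by rewrite -mulr_sumr /E (srg_idempotent st1 st2 nm); ring.
have formE : \sum_x z x * (\sum_y A x y * z y - tau * z x) =
    (theta - tau)^-1 * (\sum_x Ez x ^+ 2) + c * (\sum_x z x) ^+ 2.
  rewrite Ez2 mulKf ?gt_eqF // expr2 mulrA [X in _ + X]mulr_sumr -big_split /=.
  by apply: eq_bigr => x _; rewrite EzE; ring.
have sq1 : 0 <= (theta - tau)^-1 * \sum_x Ez x ^+ 2.
  by rewrite mulr_ge0 ?invr_ge0 ?(ltW d_gt0) // sumr_ge0 // => x _; apply: sqr_ge0.
have sq2 : 0 <= c * (\sum_x z x) ^+ 2 by rewrite mulr_ge0 ?sqr_ge0 ?ltW.
rewrite formE; split=> [|/eqP]; first exact: addr_ge0.
rewrite paddr_eq0 // (mulf_eq0 c) (mulf_eq0 (theta - tau)^-1) invr_eq0.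
rewrite (gt_eqF c_gt0) (gt_eqF d_gt0) /= sqrf_eq0.
move=> /andP[/eqP Ez0 /eqP z0] x.
have /eqP := psumr_eq0P (fun x _ => sqr_ge0 (Ez x)) Ez0 (i := x) isT.
by rewrite sqrf_eq0 EzE z0 mulr0 subr0 subr_eq0 => /eqP.
Qed.

(** * The cosine matrix I + aA + b(J - I - A) *)

Definition cosine_mx (a b : R) := scheme_mx (1 - b) (a - b) b.

Lemma cosine_mx_refl (a b : R) (x : G) : cosine_mx a b x x = 1.
Proof. by rewrite /cosine_mx /scheme_mx eqxx adj_irrefl /= mulr1n mulr0n; ring. Qed.

Lemma cosine_mx_adj (a b : R) (x y : G) : adj x y -> cosine_mx a b x y = a.
Proof.
rewrite /cosine_mx /scheme_mx => xy; rewrite xy.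
have [xy'|_] := eqVneq x y; first by rewrite xy' adj_irrefl in xy.
by rewrite /= mulr1n mulr0n; ring.
Qed.

Lemma cosine_mx_nonadj (a b : R) (x y : G) :
  x != y -> ~~ adj x y -> cosine_mx a b x y = b.
Proof.
rewrite /cosine_mx /scheme_mx => /negPf-> /negPf-> /=; rewrite mulr0n; ring.
Qed.

Section Cosines.

Variable tau : R.
Hypothesis tau_least : least_eigenvalue G tau.

Let a := adjacency_cosine k tau.
Let b := nonadjacency_cosine n k tau.

Let k_gt0 : 0 < k%:R :> R.
Proof. by rewrite ltr0n srg_degree_gt0. Qed.

(** [srg_count] trades (n-k-1)m for k(k-l-1), and k-l-1 = -(tau+1)(theta+1) by Vieta. *)
Lemma nonadjacency_cosineE theta : tau + theta = l%:R - m%:R ->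
  tau * theta = m%:R - k%:R -> 0 < theta -> b = m%:R / (k%:R * (theta + 1)).
Proof.
move=> st1 st2 th_gt0; rewrite /b /nonadjacency_cosine.
have N_gt0 : 0 < n%:R - k%:R - 1 :> R.
  have : k.+1%:R < n%:R :> R by rewrite ltr_nat srg_degree_lt.
  by rewrite -natr1; lra.
have th1 : theta + 1 != 0 by rewrite gt_eqF //; lra.
apply/eqP; rewrite eqr_div ?mulf_neq0 ?th1 ?(gt_eqF N_gt0) ?(gt_eqF k_gt0) //.
rewrite mulrC [m%:R * _]mulrC -srg_count; apply/eqP.
have -> : k%:R - l%:R - 1 = - (tau + 1) * (theta + 1) by nra.
ring.
Qed.

Lemma adjacency_cosineM : k%:R * a = tau.
Proof. by rewrite /a /adjacency_cosine mulrC divfK ?gt_eqF. Qed.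

Lemma adjacency_cosine_lt : a < b.
Proof.
have [theta [st1 st2 th_gt0 tau_lt nm]] := least_eigenvalue_root tau_least.
apply: (@lt_le_trans _ _ 0).
  by rewrite -(pmulr_rlt0 a k_gt0) adjacency_cosineM; lra.
by rewrite (nonadjacency_cosineE st1) // divr_ge0 // mulr_ge0 ?ltW //; lra.
Qed.

(** This is AM = tau M at a nonadjacent pair: m neighbors of one vertex have cosine a to the other,
    and k - m have cosine b. *)
Lemma cosine_nonadj_eq : m%:R * a + (k%:R - m%:R) * b = tau * b.
Proof.
have [theta [st1 st2 th_gt0 tau_lt nm]] := least_eigenvalue_root tau_least.
rewrite (nonadjacency_cosineE st1) // /a /adjacency_cosine.
have -> : k%:R - m%:R = - (tau * theta) by lra.
by field; rewrite !gt_eqF //=; lra.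
Qed.

(** The cosine matrix is a - b times the [E] that kills the theta-eigenspace, and E^2 = (tau -
    theta)E; both factors are negative, so c > 0. *)
Lemma cosine_mx_sqr : exists2 c : R, 0 < c &
  forall x y, \sum_w cosine_mx a b x w * cosine_mx a b w y =
    c * cosine_mx a b x y.
Proof.
have [theta [st1 st2 th_gt0 tau_lt nm]] := least_eigenvalue_root tau_least.
have ab := adjacency_cosine_lt.
have n_gt0 : 0 < n%:R :> R by rewrite ltr0n -(srg_order srgG) ltnW.
have th1 : theta + 1 != 0 by rewrite gt_eqF //; lra.
have k0 : k%:R != 0 :> R by rewrite gt_eqF.
have n0 : n%:R != 0 :> R by rewrite gt_eqF.
pose E := scheme_mx (- theta) 1 (- ((k%:R - theta) / n%:R)).
have mE : m%:R = k%:R + tau * theta by lra.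
have ME x y : cosine_mx a b x y = (a - b) * E x y.
  have -> : cosine_mx a b = scheme_mx (- ((a - b) * theta)) (a - b)
      (- ((a - b) * ((k%:R - theta) / n%:R))).
    have bE := nonadjacency_cosineE st1 st2 th_gt0.
    have abE : a - b = (tau - k%:R) / (k%:R * (theta + 1)).
      by rewrite bE mE /a /adjacency_cosine; field; rewrite th1 k0.
    congr scheme_mx; rewrite abE.
      by rewrite bE mE; field; rewrite th1 k0.
    (* Expanding by n brings in nm, which factors as (k-tau)(k-theta). *)
    have -> : b = (n%:R * m%:R) / (n%:R * (k%:R * (theta + 1))).
      by rewrite bE; field; rewrite ?n0 ?th1 ?k0.
    by rewrite nm; field; rewrite ?n0 ?th1 ?k0.
  by rewrite /E /scheme_mx; ring.
exists ((a - b) * (tau - theta)); first by rewrite nmulr_rgt0; lra.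
move=> x y.
have st1' : theta + tau = l%:R - m%:R by rewrite addrC.
have st2' : theta * tau = m%:R - k%:R by rewrite mulrC.
have nm' : n%:R * m%:R = (k%:R - theta) * (k%:R - tau) by rewrite [RHS]mulrC.
under eq_bigr do rewrite !ME mulrACA.
by rewrite -mulr_sumr (srg_idempotent st1' st2' nm') ME -/E; ring.
Qed.

End Cosines.

(* In a primitive graph, removing v and its neighbors leaves a connected
   graph: otherwise all vertices outside would have the same neighbors in
   [neighbors v], and a neighbor of v outside that common set would have too
   small a degree. *)
Lemma second_subconstituent_invariant (v u c : G) (P : pred G) :
  (forall x w, P x -> adj x w -> w != v -> ~~ adj v w -> P w) ->
  u != v -> ~~ adj v u -> P u -> c != v -> ~~ adj v c -> P c.
Proof.
move=> Pstep uv nvu Pu cv nvc; apply/negPn/negP => nPc.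
(* No common neighbor of [x] and [y] lies outside [neighbors v], or [P] would reach [y]. All m of
   them are thus common neighbors with [v], and counting gives equality. *)
have same x y : P x -> ~~ P y -> x != v -> ~~ adj v x -> y != v -> ~~ adj v y ->
    neighbors x :&: neighbors v = neighbors y :&: neighbors v.
  move=> Px nPy xv nvx yv nvy.
  have xy : x != y by apply: contraNneq nPy => <-.
  have nxy : ~~ adj x y by apply: contra nPy => xy_adj; apply: Pstep Px _ _ _.
  have sub : neighbors x :&: neighbors y \subset neighbors v.
    apply/subsetP => w; rewrite !inE => /andP[xw yw].
    apply: contraNT nPy => nvw.
    have wv : w != v by apply: contraNneq nvx => <-; rewrite adj_sym.
    by apply: (Pstep w) => //; [apply: (Pstep x) | rewrite adj_sym].
  have common z : z != v -> ~~ adj v z ->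
      neighbors x :&: neighbors y \subset neighbors z ->
      neighbors x :&: neighbors y = neighbors z :&: neighbors v.
    move=> zv nvz subz; apply/eqP; rewrite eqEcard subsetI subz sub /=.
    by rewrite (srg_nonadj srgG xy nxy) (srg_nonadj srgG zv) // adj_sym.
  by rewrite -(common x) ?subsetIl // -(common y) ?subsetIr.
pose S := neighbors u :&: neighbors v.
have allS x : x != v -> ~~ adj v x -> neighbors x :&: neighbors v = S.
  move=> xv nvx; have [Px|nPx] := boolP (P x); last by rewrite /S (same u x).
  by rewrite /S (same x c) // (same u c).
have [w wv wS] : exists2 w, w \in neighbors v & w \notin S.
  apply/subsetPn/negP => /subset_leq_card.
  rewrite (srg_regular srgG) (srg_nonadj srgG) // 1?adj_sym //.
  by rewrite leqNgt srg_mu_lt.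
move: wv; rewrite inE => vw.
have : neighbors w \subset v |: (neighbors v :&: neighbors w).
  apply/subsetP => x; rewrite !inE => wx.
  have [//|xv /=] := eqVneq x v; rewrite wx andbT.
  apply/negPn/negP => nvx; case/negP: wS; rewrite -(allS x xv nvx) !inE vw.
  by rewrite adj_sym wx.
move/subset_leq_card; rewrite cardsU1 !inE adj_irrefl /=.
by rewrite (srg_regular srgG) (srg_adj srgG vw) leqNgt add1n srg_lambda_lt.
Qed.

End StronglyRegularGraph.

(** * Pulling the cosine matrix of H back along phi *)

Section Homomorphism.

Variables (R : realType) (G H : graph).
Variables (nG kG lG mG nH kH lH mH : nat) (tauG tauH : R) (phi : G -> H).
Hypothesis srgG : strongly_regular G nG kG lG mG.
Hypothesis primG : primitive G.
Hypothesis G_gt1 : (1 < #|G|)%N.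
Hypothesis srgH : strongly_regular H nH kH lH mH.
Hypothesis primH : primitive H.
Hypothesis H_gt1 : (1 < #|H|)%N.
Hypothesis leastG : least_eigenvalue G tauG.
Hypothesis leastH : least_eigenvalue H tauH.
Hypothesis same_adj : adjacency_cosine kH tauH = adjacency_cosine kG tauG.
Hypothesis homphi : homomorphism phi.

Local Notation alpha := (adjacency_cosine kG tauG).
Local Notation betaG := (nonadjacency_cosine nG kG tauG).
Local Notation betaH := (nonadjacency_cosine nH kH tauH).

Definition pullback_mx (u v : G) : R :=
  cosine_mx alpha betaH (phi u) (phi v).

(* pullback_mx is a Gram matrix, and its inner product with the positive
   semidefinite matrix A - tauG vanishes. *)
Lemma pullback_mx_eigen (u v : G) :
  \sum_w (adj u w)%:R * pullback_mx w v = tauG * pullback_mx u v.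
Proof.
have [c c_gt0] := cosine_mx_sqr srgH primH H_gt1 leastH.
rewrite same_adj => sqr.
pose z (w : H) (x : G) := cosine_mx alpha betaH (phi x) w.
have gram x y : c * pullback_mx x y = \sum_w z w x * z w y.
  rewrite /pullback_mx -sqr; apply: eq_bigr => w _.
  by congr (_ * _); apply: scheme_mxC.
pose q w := \sum_x z w x * (\sum_y (adj x y)%:R * z w y - tauG * z w x).
have q_ge0 w : 0 <= q w.
  by have [] := least_eigenvalue_form srgG primG G_gt1 (z w) leastG.
have q_sum : \sum_w q w = 0.
  have -> : \sum_w q w = \sum_x (\sum_y (adj x y)%:R * (c * pullback_mx x y)
      - tauG * (c * pullback_mx x x)).
    rewrite exchange_big; apply: eq_bigr => x _ /=; rewrite gram.
    under eq_bigr do rewrite mulrBr; rewrite sumrB mulr_sumr.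
    congr (_ - _); last by apply: eq_bigr => w _; ring.
    under [LHS]eq_bigr do rewrite mulr_sumr.
    rewrite exchange_big.
    apply: eq_bigr => y _ /=; rewrite gram mulr_sumr.
    by apply: eq_bigr => w _; ring.
  (* Each [x] contributes c(kG alpha - tauG) = 0. *)
  apply: big1 => x _.
  have -> : \sum_y (adj x y)%:R * (c * pullback_mx x y) =
      \sum_y (adj x y)%:R * (c * alpha).
    apply: eq_bigr => y _; have [xy|] := boolP (adj x y); last by rewrite !mul0r.
    by rewrite /pullback_mx cosine_mx_adj //; apply: homphi.
  rewrite -mulr_suml (sum_adj srgG) /pullback_mx cosine_mx_refl mulrCA.
  by rewrite (adjacency_cosineM srgG primG G_gt1); ring.
have z_eig w x : \sum_y (adj x y)%:R * z w y = tauG * z w x.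
  have [_] := least_eigenvalue_form srgG primG G_gt1 (z w) leastG; apply.
  exact: psumr_eq0P (fun w _ => q_ge0 w) q_sum w isT.
apply: (mulfI (lt0r_neq0 c_gt0)); rewrite mulrCA gram mulr_sumr.
under [LHS]eq_bigr do rewrite mulrCA gram mulr_sumr.
rewrite exchange_big mulr_sumr; apply: eq_bigr => w _ /=.
by rewrite mulrA -z_eig mulr_suml; apply: eq_bigr => y _; rewrite mulrA.
Qed.

Definition separated (u v : G) : bool :=
  (phi u != phi v) && ~~ adj (phi u) (phi v).

Lemma separatedC (u v : G) : separated u v = separated v u.
Proof. by rewrite /separated eq_sym adj_sym. Qed.

Lemma separated_nonadj (u v : G) : separated u v -> (u != v) && ~~ adj u v.
Proof.
case/andP=> uv nuv; apply/andP; split; first by apply: contraNneq uv => ->.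
by apply: contra nuv; apply: homphi.
Qed.

(* The average of pullback_mx w v over the neighbors w of u outside the
   neighborhood of v is compared with betaG; the value 1 does not occur, as
   phi w = phi v would make phi u adjacent to phi v. *)
Lemma separated_step (u v : G) : betaH <= betaG -> separated u v ->
  betaH = betaG /\ forall w, adj u w -> ~~ adj v w -> separated w v.
Proof.
move=> le_beta sep; have /andP[uv nuv] := separated_nonadj sep.
have [theta [_ _ _ tau_lt _]] := least_eigenvalue_root srgG primG G_gt1 leastG.
have ab := adjacency_cosine_lt srgG primG G_gt1 leastG.
pose term w := (adj u w && ~~ adj v w)%:R * (betaG - pullback_mx w v).
have neq w : adj u w -> phi w != phi v.
  move=> uw; case/andP: sep => _; apply: contraNneq => <-.
  exact: homphi.
have val w : adj u w -> pullback_mx w v = alpha \/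
    pullback_mx w v = betaH /\ separated w v.
  move=> uw; have [wv|nwv] := boolP (adj (phi w) (phi v)).
    by left; apply: cosine_mx_adj.
  right; split; last by rewrite /separated neq.
  by apply: cosine_mx_nonadj => //; apply: neq.
have term_ge0 w : 0 <= term w.
  rewrite /term; have [/andP[uw _]|_] := boolP (_ && _); last by rewrite mul0r.
  by rewrite mul1r; have [->|[-> _]] := val w uw; lra.
(* The sum is kG betaG - tauG betaH - mG(betaG - alpha); [cosine_nonadj_eq] finishes. *)
have sum_term : \sum_w term w = tauG * (betaG - betaH).
  have -> : \sum_w term w = \sum_w (adj u w)%:R * (betaG - pullback_mx w v)
      - \sum_w (adj u w)%:R * (adj w v)%:R * (betaG - alpha).
    rewrite -sumrB; apply: eq_bigr => w _; rewrite /term (adj_sym v).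
    have [wv|_] := boolP (adj w v); last by rewrite andbT /= mulr0n; ring.
    by rewrite andbF /pullback_mx cosine_mx_adj /= ?mulr0n ?mulr1n; [ring | apply: homphi].
  under eq_bigr do rewrite mulrBr.
  rewrite sumrB -!mulr_suml (sum_adj srgG) pullback_mx_eigen (sum_adj_adj srgG).
  rewrite (negPf uv) (negPf nuv) /= mulr0n.
  have -> : pullback_mx u v = betaH.
    by case/andP: sep => ? ?; apply: cosine_mx_nonadj.
  have := cosine_nonadj_eq srgG primG G_gt1 leastG; lra.
have beta_eq : betaH = betaG.
  have : 0 <= \sum_w term w by apply: sumr_ge0.
  rewrite sum_term nmulr_rge0; lra.
split=> // w uw nvw.
have sum0 : \sum_w term w = 0 by rewrite sum_term beta_eq subrr mulr0.
have : term w = 0 by apply: psumr_eq0P (fun w _ => term_ge0 w) sum0 w isT.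
rewrite /term uw nvw mul1r.
by have [-> ?|[_ ? //]] := val w uw; exfalso; lra.
Qed.

Lemma coloring_or_separated :
  coloring phi \/ exists u v, separated u v.
Proof.
case: (boolP [exists u, [exists v, separated u v]]).
  by move=> /existsP[u /existsP[v sep]]; right; exists u, v.
move=> nosep; left; split=> // _ _ /imsetP[u _ ->] /imsetP[v _ ->] uv.
apply: contraNT nosep => nuv; apply/existsP; exists u; apply/existsP.
by exists v; rewrite /separated uv.
Qed.

Lemma separated_induced_embedding (u v : G) : betaH = betaG ->
  separated u v -> induced_embedding phi.
Proof.
move=> eq_beta sep.
(* For fixed [x], separation from [x] passes along edges between non-neighbors of [x], which induce
   a connected graph. *)
have spread x : (exists y, separated y x) ->
    forall c, c != x -> ~~ adj x c -> separated c x.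
  move=> [y yx] c cx nxc; have /andP[y_neq ny] := separated_nonadj yx.
  have nxy : ~~ adj x y by rewrite adj_sym.
  apply: (second_subconstituent_invariant srgG primG G_gt1
    (P := fun w => separated w x) (v := x) (u := y)) => // w w' wx ww' _ nxw'.
  have le_beta : betaH <= betaG by rewrite eq_beta.
  by have [_ ->] := separated_step le_beta wx.
(* Being separated from some vertex spreads along edges of the complement. *)
have all_sep x : exists y, separated y x.
  apply: (connect_invariant (P := fun x => exists y, separated y x))
    (primG.2 v x); last by exists u.
  move=> a b sep_a /= /andP[ab nab]; exists a; rewrite separatedC.
  by apply: spread => //; rewrite eq_sym.
have sepP x y : x != y -> ~~ adj x y -> separated x y.
  by move=> xy nxy; apply: spread; rewrite // adj_sym.
split=> [x y exy|x y].
  apply/eqP/negPn/negP => xy; have [/homphi|nxy] := boolP (adj x y).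
    by rewrite exy adj_irrefl.
  by case/andP: (sepP x y xy nxy) => /eqP.
split=> [|hxy]; first exact: homphi.
have [xy|xy] := eqVneq x y; first by rewrite xy adj_irrefl in hxy.
by apply: contraTT hxy => nxy; case/andP: (sepP x y xy nxy).
Qed.

End Homomorphism.

Theorem theorem3p4 (R : realType) (G H : graph)
    (nG kG lambdaG muG nH kH lambdaH muH : nat)
    (tauG tauH alpha beta beta' : R) (phi : G -> H) :
  strongly_regular G nG kG lambdaG muG -> primitive G ->
  strongly_regular H nH kH lambdaH muH -> primitive H ->
  least_eigenvalue G tauG -> least_eigenvalue H tauH ->
  adjacency_cosine kG tauG = alpha ->
  adjacency_cosine kH tauH = alpha ->
  nonadjacency_cosine nG kG tauG = beta ->
  nonadjacency_cosine nH kH tauH = beta' ->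
  homomorphism phi ->
  (beta' < beta -> coloring phi) /\
  (beta = beta' -> coloring phi \/ induced_embedding phi).
Proof.
move=> srgG primG srgH primH leastG leastH alphaG alphaH betaE betaE' homphi.
have [G_le1|G_gt1] := leqP #|G| 1.
  by have col := coloring_subsingleton homphi (or_introl G_le1); split; auto.
have [H_le1|H_gt1] := leqP #|H| 1.
  by have col := coloring_subsingleton homphi (or_intror H_le1); split; auto.
have same_adj : adjacency_cosine kH tauH = adjacency_cosine kG tauG.
  by rewrite alphaG alphaH.
have [col|[u [v sep]]] := coloring_or_separated homphi; first by split; auto.
split=> [lt_beta|eq_beta].
  have le_beta : nonadjacency_cosine nH kH tauH <= nonadjacency_cosine nG kG tauG.
    by rewrite betaE betaE' ltW.
  have [] := separated_step srgG primG G_gt1 srgH primH H_gt1 leastG leastH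
    same_adj homphi le_beta sep.
  by rewrite betaE betaE' => e; rewrite e ltxx in lt_beta.
right; apply: (separated_induced_embedding srgG primG G_gt1 srgH primH H_gt1
  leastG leastH same_adj homphi _ sep).
by rewrite betaE betaE'.
Qed.
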